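(* Let $0<\mu<1$, $0\le\nu\le1$, $\eta=\mu+\nu-\mu\nu$, $a\in\mathbb{R}$, $T=a+k$ with $k$ a positive integer, and let $g:\mathbb{N}_a^T\times\mathbb{R}\to\mathbb{R}$ satisfy, for some $K>0$, $|g(x,u)-g(x,v)|\le K|u-v|$ for all $x\in\mathbb{N}_a^T$ and $u,v\in\mathbb{R}$. For $\xi\in\mathbb{R}$ consider the Hilfer fractional difference system $$\Delta_a^{\mu,\nu}w(x)+g\big(x+\mu-1,w(x+\mu-1)\big)=0\quad (x\in\mathbb{N}_{a+1-\mu},\ x\le T),\qquad \Delta_a^{-(1-\eta)}w(a+1-\eta)=\xi .$$ Then the solution is stable with respect to the initial value: if $\zeta_n\to\zeta$ in $\mathbb{R}$, $u:\mathbb{N}_a^T\to\mathbb{R}$ is a solution with $\xi=\zeta$, and $v_n:\mathbb{N}_a^T\to\mathbb{R}$ is a solution with $\xi=\zeta_n$ for each $n$, then $|u(x)-v_n(x)|\to0$ as $n\to\infty$ for every $x\in\mathbb{N}_a^T$.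
   Context: For $b\in\mathbb{R}$, $\mathbb{N}_b=\{b,b+1,b+2,\dots\}$ and $\mathbb{N}_a^{T}=\{a,a+1,\dots,T\}$. $\sigma(t)=t+1$; $\Delta f(x)=f(x+1)-f(x)$; $t^{\underline{\alpha}}=\Gamma(t+1)/\Gamma(t+1-\alpha)$ (value $0$ if only the denominator has a pole); $h_{\alpha}(t,s)=\frac{(t-s)^{\underline{\alpha}}}{\Gamma(\alpha+1)}$. Delta fractional sum: for $\alpha>0$, $\Delta_b^{-\alpha}f(x)=\sum_{\tau=b}^{x-\alpha}h_{\alpha-1}(x,\sigma(\tau))f(\tau)$ for $x\in\mathbb{N}_{b+\alpha}$; order $0$ is the identity. Hilfer fractional difference of order $0<\mu<1$ and type $0\le\nu\le1$: $\Delta_a^{\mu,\nu}f(x)=\Delta_{a+(1-\nu)(1-\mu)}^{-\nu(1-\mu)}\,\Delta\,\Delta_a^{-(1-\nu)(1-\mu)}f(x)$, $x\in\mathbb{N}_{a+1-\mu}$. For $x\in\mathbb{N}_{a+1-\mu}$ with $x\le T$ it involves only the values of $f$ on $\mathbb{N}_a^T$. *)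

(* Defs.v *)
From HB Require Import structures.
From mathcomp Require Import all_boot all_order all_algebra.
From mathcomp Require Import all_classical all_reals all_analysis.

Set Implicit Arguments.
Unset Strict Implicit.
Unset Printing Implicit Defensive.

Import Order.TTheory GRing.Theory Num.Theory.
Import numFieldNormedType.Exports.

Local Open Scope classical_set_scope.
Local Open Scope ring_scope.

Section Defs.
Variable R : realType.
Implicit Types (a b x t s alpha : R) (f w : R -> R).

Definition Gamma_pos x : R :=
  \int[lebesgue_measure]_(t in `]0, +oo[) (t `^ (x - 1) * expR (- t)).

(* For x <= 0 this is Gamma (x + n) / (x (x + 1) ... (x + n - 1)), where n is
   the least natural number such that x + n > 0.  At the poles x = 0, -1, ...
   the product vanishes, so that Gamma x = 0 since y / 0 = 0. *)
Definition Gamma x : R :=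
  if 0 < x then Gamma_pos x
  else let n := (Num.truncn (- x)).+1 in
       Gamma_pos (x + n%:R) / \prod_(i < n) (x + i%:R).

(* If only the denominator has a pole, its value is 0 and so is the quotient. *)
Definition falling t alpha : R := Gamma (t + 1) / Gamma (t + 1 - alpha).

Definition h alpha t s : R := falling (t - s) alpha / Gamma (alpha + 1).

Definition Nfrom b : set R := [set b + n%:R | n in [set: nat]].

Definition Nfromto b x : set R := [set t | Nfrom b t /\ t <= x].

Definition sigma t : R := t + 1.

Definition Delta f x : R := f (x + 1) - f x.

(* Functions on a lattice are total functions on R.  The values of
   [delta_sum b alpha f] matter only on [Nfrom (b + alpha)]; there, the sum runs
   over b, b + 1, ..., x - alpha. *)
Definition delta_sum b alpha f x : R :=
  if alpha == 0 then f x
  else \sum_(tau \in Nfromto b (x - alpha)) h (alpha - 1) x (sigma tau) * f tau.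

Definition hilfer a mu nu f x : R :=
  delta_sum (a + (1 - nu) * (1 - mu)) (nu * (1 - mu))
    (Delta (delta_sum a ((1 - nu) * (1 - mu)) f)) x.

Definition hilfer_solution a mu nu eta T (g : R -> R -> R) xi w : Prop :=
  (forall x, Nfrom (a + 1 - mu) x -> x <= T ->
     hilfer a mu nu w x + g (x + mu - 1) (w (x + mu - 1)) = 0) /\
  delta_sum a (1 - eta) w (a + 1 - eta) = xi.

End Defs.

(* Main.v *)
Require Import Defs.
From HB Require Import structures.
From mathcomp Require Import all_boot all_order all_algebra.
From mathcomp Require Import all_classical all_reals all_analysis.
From mathcomp Require Import measurable_realfun ring lra.
Import Order.TTheory GRing.Theory Num.Theory.
Import numFieldNormedType.Exports.
Local Open Scope classical_set_scope.
Local Open Scope ring_scope.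

(** On the lattice the Hilfer equation is an explicit recursion, and this is why
    the solution depends continuously on its initial value.  Put
    alpha = (1 - nu)(1 - mu) and beta = nu (1 - mu), so that 1 - eta = alpha and
    alpha + beta = 1 - mu.  For an order alpha in [0, 1] the value of the
    fractional sum of f at b + alpha + m is f (b + m) plus a linear combination
    of f b, ..., f (b + m - 1), with coefficients independent of f
    ([delta_sum_unitriangular]).  Such a unitriangular system transports
    convergence in both directions: convergence of f_n at b, ..., b + m gives
    convergence of the sums at b + alpha + m ([delta_sum_cvg]), and convergence
    of the sums at b + alpha + m together with that of f_n at the earlier points
    gives convergence of f_n at b + m ([delta_sum_cvg_inv]).

    The theorem follows by strong induction on m for the point a + m.  Let W w
    be the sum of order alpha of w.  At m = 0 the initial condition prescribes
    W w (a + alpha), and inverting the sum gives w a.  If v_n converges to u at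
    a, ..., a + m, then W (v_n) converges up to a + alpha + m, and the Lipschitz
    condition makes the nonlinear term g (a + m, v_n (a + m)) converge.  By the
    equation so does the sum of order beta of Delta (W v_n) at
    a + alpha + beta + m.  Inverting that sum gives the limit of
    Delta (W v_n) at a + alpha + m, hence that of W v_n at a + alpha + m + 1, and
    inverting the sum of order alpha gives the limit of v_n at a + m + 1.

    The leading coefficient of the sum of order alpha > 0 is
    Gamma alpha / (Gamma 1 * Gamma alpha).  It equals 1 because Gamma 1 = 1
    ([Gamma1]) and Gamma alpha <> 0 ([Gamma_neq0]); the latter requires Euler's
    integral to be finite and positive for 0 < alpha <= 1. *)

(** * Euler's integral on ]0, 1] *)

Lemma measurable_Gamma_integrand {R : realType} (x : R) (D : set R) :
  measurable D ->
  measurable_fun D (fun t : R => t `^ (x - 1) * expR (- t)).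
Proof.
move=> mD; apply: measurable_funTS.
apply: measurable_funM; first exact: measurable_powR.
exact: measurableT_comp.
Qed.

(** Since 1 - exp (- t) <= t and x - 1 <= 0, replacing t by 1 - exp (- t) in the
    power only increases it.  The right-hand side is the derivative of the
    bounded function (1 - exp (- t)) ^ x, which thus controls Euler's integral
    at 0 and at infinity simultaneously. *)
Lemma Gamma_integrand_le {R : realType} (x t : R) : 0 < x -> x <= 1 -> 0 < t ->
  x * (t `^ (x - 1) * expR (- t)) <=
  x * (1 - expR (- t)) `^ (x - 1) * expR (- t).
Proof.
move=> x0 x1 t0; rewrite mulrA ler_pM2r ?expR_gt0// ler_pM2l//.
have e0 : 0 < 1 - expR (- t) by rewrite subr_gt0 expR_lt1 oppr_lt0.
rewrite -(opprB 1 x) 2!powRN lef_pV2 ?posrE ?powR_gt0//.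
apply: ge0_ler_powR; rewrite ?nnegrE ?subr_ge0 ?(ltW t0)//.
  by rewrite -subr_ge0 ltW.
by have := expR_ge1Dx (- t); lra.
Qed.

Lemma is_derive_powR_1BexpRN {R : realType} (x : R) {t : R} : 0 < t ->
  is_derive t 1 (fun s : R => (1 - expR (- s)) `^ x)
    (x * (1 - expR (- t)) `^ (x - 1) * expR (- t)).
Proof.
move=> t0.
have e0 : 0 < 1 - expR (- t) by rewrite subr_gt0 expR_lt1 oppr_lt0.
have dN : is_derive t 1 (fun s : R => 1 - expR (- s)) (expR (- t)).
  have de := is_derive1_comp (is_derive_expR (- t)) (is_deriveN (is_derive_id t 1)).
  apply: is_derive_eq (is_deriveB (is_derive_cst (1 : R) t 1) de) _.
  by rewrite sub0r mulrN1 opprK.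
exact: (@is_derive1_comp _ (@powR R ^~ x) (fun s => 1 - expR (- s)) _ _ _
  (is_derive1_powR x e0) dN).
Qed.

(** The lower end is a positive c because the derivative of (1 - exp (- t)) ^ x
    may be unbounded near 0, where the fundamental theorem of calculus on a
    closed half-line does not apply. *)
Lemma Gamma_tail_le {R : realType} {x c : R} : 0 < x -> x <= 1 -> 0 < c ->
  (x%:E * \int[lebesgue_measure]_(t in `[c, +oo[) (t `^ (x - 1) * expR (- t))%:E
    <= 1)%E.
Proof.
move=> x0 x1 c0.
have fge0 (t : R) : (0 <= (t `^ (x - 1) * expR (- t))%:E)%E.
  by rewrite lee_fin mulr_ge0 ?powR_ge0 ?expR_ge0.
rewrite -ge0_integralZl_EFin//; last 2 first.
- by apply/measurable_EFinP; exact: measurable_Gamma_integrand.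
- exact: ltW.
pose F (s : R) := (1 - expR (- s)) `^ x.
pose G (t : R) := x * (1 - expR (- t)) `^ (x - 1) * expR (- t).
have Gge0 t : 0 <= G t by rewrite !mulr_ge0 ?powR_ge0 ?expR_ge0// ltW.
have dF (t : R) : 0 < t -> is_derive t 1 F (G t).
  exact: is_derive_powR_1BexpRN.
have mG : measurable_fun `[c, +oo[ (EFin \o G).
  apply/measurable_EFinP; apply: measurable_funTS.
  apply: measurable_funM; last exact: measurableT_comp.
  apply: measurable_funM => //.
  apply: (measurableT_comp (measurable_powR _)).
  by apply: measurable_funB => //; exact: measurableT_comp.
apply: (@le_trans _ _ (\int[lebesgue_measure]_(t in `[c, +oo[) (G t)%:E)%E).
  apply: ge0_le_integral => //.
  - by move=> t _; apply: mule_ge0; [rewrite lee_fin ltW|exact: fge0].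
  - apply: measurable_funeM.
    by apply/measurable_EFinP; exact: measurable_Gamma_integrand.
  - move=> t /=; rewrite in_itv/= andbT => ct.
    by rewrite -EFinM lee_fin Gamma_integrand_le// (lt_le_trans c0).
rewrite (@ge0_continuous_FTC2y _ G F c 1) //.
- by rewrite -EFinB lee_fin lerBlDr lerDl powR_ge0.
- apply: derivable_within_continuous => t; rewrite in_itv/= andbT => ct.
  have t0 : 0 < t := lt_le_trans c0 ct.
  have e0 : 0 < 1 - expR (- t) by rewrite subr_gt0 expR_lt1 oppr_lt0.
  have de := is_derive_powR_1BexpRN (x - 1) t0.
  exact: derivableM.
- have powx1 : {for (1 : R), continuous (@powR R ^~ x)}.
    apply/differentiable_continuous/derivable1_diffP.
    by case: (is_derive1_powR x (@ltr01 R)).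
  have {}powx1 : s `^ x @[s --> (1 : R)] --> (1 : R).
    by move: powx1; rewrite /prop_for /continuous_at/= (_ : 1 `^ x = 1) // powR1.
  have B1 : 1 - expR (- s) @[s --> +oo] --> (1 : R).
    rewrite -[X in _ --> X](subr0 (1 : R)).
    by apply: cvgB; [exact: cvg_cst|exact: cvgr_expR].
  exact: (cvg_comp _ _ B1 powx1).
- by move=> t ct; case: (dF t (lt_trans c0 ct)).
- case: (dF c c0) => dFc _.
  apply: cvg_at_right_filter.
  exact/differentiable_continuous/derivable1_diffP.
- move=> t; rewrite in_itv/= andbT => ct; rewrite derive1E.
  by case: (dF t (lt_trans c0 ct)).
Qed.

(** The bound 1 / x of [Gamma_tail_le] does not depend on c, so it survives the
    monotone limit along c = 1 / (k + 1). *)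
Lemma Gamma_integral_lty {R : realType} (x : R) : 0 < x -> x <= 1 ->
  (\int[lebesgue_measure]_(t in `]0%R, +oo[) (t `^ (x - 1) * expR (- t))%:E
    < +oo)%E.
Proof.
move=> x0 x1; apply: (@le_lt_trans _ _ (x^-1)%:E); last exact: ltry.
rewrite itvoyEbigcup.
have cvgI := @ge0_nondecreasing_set_cvg_integral _ (measurableTypeR R) R
  (fun k => `[0 + k.+1%:R^-1, +oo[%classic)
  (fun t : R => (t `^ (x - 1) * expR (- t))%:E) lebesgue_measure.
apply: cvge_le (cvgI _ _ _ _); last 4 first.
- move=> m n mn; apply/subsetPset => t /=; rewrite !in_itv/= !andbT.
  by apply: le_trans; rewrite !add0r lef_pV2 ?posrE ?ltr0Sn// ler_nat.
- by move=> k; exact: measurable_itv.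
- by move=> k; apply/measurable_EFinP; exact: measurable_Gamma_integrand.
- by move=> k t _; rewrite lee_fin mulr_ge0 ?powR_ge0 ?expR_ge0.
apply: nearW => k.
have k0 : 0 < 0 + k.+1%:R^-1 :> R by rewrite add0r invr_gt0 ltr0Sn.
rewrite -[leRHS]mul1e lee_pdivlMr//.
by rewrite muleC; exact: Gamma_tail_le.
Qed.

(** Finiteness matters here: a real-valued integral is 0 by convention when the
    extended-real integral is infinite. *)
Lemma Gamma_pos_gt0 {R : realType} (x : R) : 0 < x -> x <= 1 ->
  0 < Gamma_pos x.
Proof.
move=> x0 x1; rewrite /Gamma_pos /Rintegral; apply: fine_gt0.
rewrite Gamma_integral_lty// andbT.
(* A lower bound of the integrand on [1, 2], as t ^ (x - 1) >= 1 / t there. *)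
pose m : R := 2^-1 * expR (- 2).
have m0 : 0 < m by rewrite mulr_gt0 ?expR_gt0// invr_gt0.
apply: (@lt_le_trans _ _
  (\int[lebesgue_measure]_(t in `[1%R, 2%R]) (cst m%:E t))%E).
  rewrite integral_cst// [X in (_ * X)%E]lebesgue_measure_itv/= lte_fin ltr1n/=.
  by rewrite -EFinB -EFinM lte_fin mulr_gt0// subr_gt0 ltr1n.
apply: (@le_trans _ _ (\int[lebesgue_measure]_(t in `[1%R, 2%R])
    (t `^ (x - 1) * expR (- t))%:E)%E).
  apply: ge0_le_integral => //.
  - by move=> t _; rewrite lee_fin ltW.
  - by apply/measurable_EFinP; exact: measurable_Gamma_integrand.
  - move=> t /=; rewrite in_itv/= => /andP[t1 t2].
    have t0 : 0 < t := lt_le_trans ltr01 t1.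
    rewrite lee_fin ler_pM ?invr_ge0 ?expR_ge0// ?ler_expR ?lerN2//.
    apply: (@le_trans _ _ (t `^ (- 1))).
      by rewrite powR_inv1 ?(ltW t0)// lef_pV2 ?posrE.
    by apply: ler_powR => //; lra.
apply: ge0_subset_integral => //.
- by apply/measurable_EFinP; exact: measurable_Gamma_integrand.
- by move=> t _; rewrite lee_fin mulr_ge0 ?powR_ge0 ?expR_ge0.
- move=> t /=; rewrite !in_itv/= andbT => /andP[t1 _].
  exact: lt_le_trans t1.
Qed.

Lemma Gamma_neq0 {R : realType} (x : R) : 0 < x -> x <= 1 -> Gamma x != 0.
Proof. by move=> x0 x1; rewrite /Gamma x0 gt_eqF// Gamma_pos_gt0. Qed.

Lemma Gamma1 (R : realType) : Gamma (1 : R) = 1.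
Proof.
rewrite /Gamma ltr01 /Gamma_pos subrr.
under eq_Rintegral do rewrite powRr0 mul1r.
rewrite /Rintegral integral_itv_obnd_cbnd; last first.
  by apply/measurable_EFinP; apply: measurable_funTS; exact: measurableT_comp.
have dE (t : R) : is_derive t 1 (fun s : R => - expR (- s)) (expR (- t)).
  have de := is_derive1_comp (is_derive_expR (- t))
    (is_deriveN (is_derive_id t 1)).
  by apply: is_derive_eq (is_deriveN de) _; rewrite mulrN1 opprK.
have dcont (t : R) : {for t, continuous (fun s : R => - expR (- s))}.
  apply/differentiable_continuous/derivable1_diffP.
  by case: (dE t).
rewrite (@ge0_continuous_FTC2y _ _ (fun s => - expR (- s)) 0 0).
- by rewrite -EFinB/= oppr0 expR0 sub0r opprK.
- by move=> t _; exact: expR_ge0.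
- apply: continuous_subspaceT => t; apply: continuous_comp.
    exact: opp_continuous.
  exact: continuous_expR.
- by rewrite -[X in _ --> X]oppr0; apply: cvgN; exact: cvgr_expR.
- by move=> t _; case: (dE t).
- exact/cvg_at_right_filter/dcont.
- by move=> t _; rewrite derive1E; case: (dE t).
Qed.

(** * Fractional sums as unitriangular linear maps *)

Lemma Nfromto_addn (R : realType) (b : R) (m : nat) :
  Nfromto b (b + m%:R) = [set b + i%:R | i in `I_m.+1].
Proof.
apply/seteqP; split=> [t [[i _ <-]]|t [i /= im <-]].
  by rewrite lerD2l ler_nat => im; exists i.
by split; [exists i|rewrite lerD2l ler_nat -ltnS].
Qed.

(** The kernel of the fractional sum at the last summation point. *)
Lemma h_diag (R : realType) (alpha s : R) : 0 < alpha -> alpha <= 1 ->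
  h (alpha - 1) (s + alpha) (sigma s) = 1.
Proof.
move=> a0 a1; rewrite /h /falling /sigma.
rewrite (_ : s + alpha - (s + 1) + 1 = alpha); last by ring.
rewrite (_ : alpha - (alpha - 1) = 1); last by ring.
by rewrite subrK Gamma1 divr1 divff// Gamma_neq0.
Qed.

(** The summation points for b + alpha + m are b, ..., b + m, and the weight of
    the last one is given by [h_diag].  Order 0 is the case c = 0. *)
Lemma delta_sum_unitriangular {R : realType} (b : R) {alpha : R} :
  0 <= alpha -> alpha <= 1 ->
  exists c : nat -> nat -> R, forall (f : R -> R) (m : nat),
    delta_sum b alpha f (b + alpha + m%:R) =
    \sum_(i < m) c m i * f (b + i%:R) + f (b + m%:R).
Proof.
rewrite le_eqVlt => /predU1P[<- _|a0 a1].
  exists (fun _ _ => 0) => f m; rewrite /delta_sum eqxx addr0 big1 ?add0r//.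
  by move=> i _; rewrite mul0r.
exists (fun m i => h (alpha - 1) (b + alpha + m%:R) (sigma (b + i%:R))) => f m.
rewrite /delta_sum gt_eqF// (_ : b + alpha + m%:R - alpha = b + m%:R); last by ring.
rewrite Nfromto_addn fsbig_image; last first.
  by move=> i j _ _ /addrI/eqP; rewrite eqr_nat => /eqP.
rewrite -fsbig_ord big_ord_recr/=.
by rewrite (addrAC b) h_diag// mul1r.
Qed.

Lemma delta_sum_cvg {R : realType} {b alpha : R} (F : nat -> R -> R) (f : R -> R)
    (m : nat) :
  0 <= alpha -> alpha <= 1 ->
  (forall i, (i <= m)%N -> F n (b + i%:R) @[n --> \oo] --> f (b + i%:R)) ->
  delta_sum b alpha (F n) (b + alpha + m%:R) @[n --> \oo] -->
  delta_sum b alpha f (b + alpha + m%:R).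
Proof.
move=> alpha_ge0 alpha_le1 Ff.
have [c cE] := delta_sum_unitriangular b alpha_ge0 alpha_le1.
rewrite cE; under eq_fun do rewrite cE.
apply: cvgD; last exact: Ff.
apply: cvg_big => [|i _]; first by move=> *; exact: add_continuous.
by apply: cvgMl_tmp; apply: Ff; exact: ltnW.
Qed.

(** Forward substitution in the unitriangular system. *)
Lemma delta_sum_cvg_inv {R : realType} {b alpha : R} (F : nat -> R -> R) (f : R -> R)
    (m : nat) :
  0 <= alpha -> alpha <= 1 ->
  (forall i, (i < m)%N -> F n (b + i%:R) @[n --> \oo] --> f (b + i%:R)) ->
  delta_sum b alpha (F n) (b + alpha + m%:R) @[n --> \oo] -->
    delta_sum b alpha f (b + alpha + m%:R) ->
  F n (b + m%:R) @[n --> \oo] --> f (b + m%:R).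
Proof.
move=> alpha_ge0 alpha_le1 Ff.
have [c cE] := delta_sum_unitriangular b alpha_ge0 alpha_le1.
rewrite cE; under eq_fun do rewrite cE.
have Sf : \sum_(i < m) c m i * F n (b + i%:R) @[n --> \oo] -->
    \sum_(i < m) c m i * f (b + i%:R).
  apply: cvg_big => [|i _]; first by move=> *; exact: add_continuous.
  by apply: cvgMl_tmp; exact: Ff.
move=> Df; under eq_fun => n do
  rewrite -[F n _](addKr (\sum_(i < m) c m i * F n (b + i%:R))).
rewrite -[f _](addKr (\sum_(i < m) c m i * f (b + i%:R))).
by apply: cvgD => //; exact: cvgN.
Qed.

(** * Continuous dependence on the initial value *)

Theorem theorem5p5 (R : realType) (mu nu eta a T K : R) (k : nat)
    (g : R -> R -> R)
    (mu_gt0 : 0 < mu) (mu_lt1 : mu < 1)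
    (nu_ge0 : 0 <= nu) (nu_le1 : nu <= 1)
    (etaE : eta = mu + nu - mu * nu)
    (k_gt0 : (0 < k)%N) (TE : T = a + k%:R)
    (K_gt0 : 0 < K)
    (g_lip : forall x, Nfromto a T x ->
       forall u v : R, `|g x u - g x v| <= K * `|u - v|)
    (zeta : R) (zetas : nat -> R) (u : R -> R) (v : nat -> R -> R)
    (zetas_cvg : zetas n @[n --> \oo] --> zeta)
    (u_sol : hilfer_solution a mu nu eta T g zeta u)
    (v_sol : forall n, hilfer_solution a mu nu eta T g (zetas n) (v n)) :
  forall x, Nfromto a T x -> `|u x - v n x| @[n --> \oo] --> (0 : R).
Proof.
suff vu m : (m <= k)%N -> v n (a + m%:R) @[n --> \oo] --> u (a + m%:R).
  move=> x [[m _ <-]]; rewrite TE lerD2l ler_nat => mk.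
  rewrite -(normr0 R) -(subrr (u (a + m%:R))).
  by apply: cvg_norm; apply: cvgB; [exact: cvg_cst|exact: vu].
pose alpha := (1 - nu) * (1 - mu); pose beta := nu * (1 - mu).
have alpha0 : 0 <= alpha by rewrite mulr_ge0// subr_ge0// ltW.
have alpha1 : alpha <= 1 by rewrite mulr_ile1//; lra.
have beta0 : 0 <= beta by rewrite mulr_ge0// subr_ge0 ltW.
have beta1 : beta <= 1 by rewrite mulr_ile1//; lra.
have etaC : 1 - eta = alpha by rewrite etaE /alpha; ring.
have ab : alpha + beta = 1 - mu by rewrite /alpha /beta; ring.
elim/ltn_ind: m => -[_ _|m IH mk].
  apply: (delta_sum_cvg_inv _ _ _ alpha0 alpha1) => //.
  have W0 xi w : hilfer_solution a mu nu eta T g xi w ->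
      delta_sum a alpha w (a + alpha + 0%:R) = xi.
    by case=> _; rewrite etaC addr0 -addrA etaC.
  by rewrite (W0 _ _ u_sol); under eq_fun do rewrite (W0 _ _ (v_sol _)).
have {}IH i : (i <= m)%N -> v n (a + i%:R) @[n --> \oo] --> u (a + i%:R).
  by move=> im; apply: IH => //; exact: leq_trans (ltnW mk).
pose W (w : R -> R) := delta_sum a alpha w.
have DE w i : Delta (W w) (a + alpha + i%:R) =
    W w (a + alpha + i.+1%:R) - W w (a + alpha + i%:R).
  by rewrite /Delta -(addrA _ i%:R) natr1.
have Wcvg i : (i <= m)%N ->
    W (v n) (a + alpha + i%:R) @[n --> \oo] --> W u (a + alpha + i%:R).
  move=> im; apply: delta_sum_cvg => // j ji; exact/IH/(leq_trans ji).
(* The point at which the equation involves g (a + m, w (a + m)). *)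
pose x := a + alpha + beta + m%:R.
have xE : x = a + (1 - mu) + m%:R by rewrite /x -ab; ring.
have hilferE xi w : hilfer_solution a mu nu eta T g xi w ->
    delta_sum (a + alpha) beta (Delta (W w)) x =
    - g (a + m%:R) (w (a + m%:R)).
  case=> eqw _; apply/eqP; rewrite -addr_eq0; apply/eqP.
  have <- : x + mu - 1 = a + m%:R by rewrite xE; ring.
  apply: eqw; first by exists m => //; rewrite xE; ring.
  have : m.+1%:R <= k%:R :> R by rewrite ler_nat.
  by rewrite TE xE -natr1; lra.
have gcvg : g (a + m%:R) (v n (a + m%:R)) @[n --> \oo] -->
    g (a + m%:R) (u (a + m%:R)).
  have Gam : Nfromto a T (a + m%:R).
    by rewrite TE Nfromto_addn; exists m => //=; rewrite ltnS ltnW.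
  apply/cvgrPdist_le => e e0.
  have eK : 0 < e / K by rewrite divr_gt0.
  have /cvgrPdist_le/(_ _ eK) := IH m (leqnn m).
  apply: filterS => n vnu; apply: le_trans (g_lip _ Gam _ _) _.
  by rewrite mulrC -ler_pdivlMr.
have DWcvg : Delta (W (v n)) (a + alpha + m%:R) @[n --> \oo] -->
    Delta (W u) (a + alpha + m%:R).
  apply: (delta_sum_cvg_inv (fun n => Delta (W (v n))) _ _ beta0 beta1) => [i im|].
    rewrite DE; under eq_fun do rewrite DE.
    by apply: cvgB; apply: Wcvg => //; exact: ltnW.
  rewrite -/x (hilferE _ _ u_sol).
  under eq_fun do rewrite (hilferE _ _ (v_sol _)).
  exact: cvgN.
apply: (delta_sum_cvg_inv _ _ _ alpha0 alpha1) => [i|]; first exact: IH.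
have {}DE w : delta_sum a alpha w (a + alpha + m.+1%:R) =
    Delta (W w) (a + alpha + m%:R) + W w (a + alpha + m%:R).
  by rewrite DE subrK.
rewrite DE; under eq_fun do rewrite DE.
by apply: cvgD => //; exact: Wcvg.
Qed.
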